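(* Let $F=\mathbb{F}_q$ and let $L/F$ be a non-trivial finite field extension. Then $L$ is additively generated by $U_{L/F}^{\pm}$, i.e., the Cayley graph $\Gamma(L,U_{L/F}^{\pm})$ is always connected. Furthermore, $m(L/F)$ has values $2,3,4$, and they occur as follows: (1) $m(L/F)=2$ if $[L:F]\geq 3$, or $[L:F]=2$ and $q\in\{2,3\}$. (2) $m(L/F)=3$ if $[L:F]=2$, $q\notin\{2,3\}$, and either $q\equiv 0\pmod 3$, or $q\equiv 5\pmod 6$, or $q=2^s$ with $s$ odd. (3) $m(L/F)=4$ if $[L:F]=2$ and either $q\equiv 1\pmod 6$ or $q=2^s$ with $s$ even.
   Context: $\mathbb{F}_q$ is the finite field with $q$ elements. Let $N\colon L\to F$ be the norm map, $U_{L/F}=\{u\in L^\times\mid N(u)=1\}$ and $U_{L/F}^{\pm}=\{\pm u\mid u\in U_{L/F}\}$. For a subset $S$ of a ring $R$, $R$ has the $n$-sum property with respect to $S$ if every element of $R$ can be written as a sum of exactly $n$ elements of $S$ (repetitions allowed). Define $m(L/F)=\min\{n\geq 1: L\text{ has the }n\text{-sum property with respect to }U_{L/F}^{\pm}\}$. The Cayley graph $\Gamma(R,S)$ has vertex set $R$, with $a,b$ adjacent if $a-b\in S$. *)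

(* Defs.v *)
From HB Require Import structures.
From mathcomp Require Export all_boot all_order all_algebra all_fingroup all_field.

Set Implicit Arguments.
Unset Strict Implicit.
Unset Printing Implicit Defensive.

Import GRing.Theory.
Local Open Scope ring_scope.

Definition n_sum_property (R : nzRingType) (S : {pred R}) (n : nat) : Prop :=
  forall x : R,
    exists2 s : n.-tuple R, {subset s <= S} & x = \sum_(y <- s) y.

(* [n] is the minimum of the set of positive integers [k] for which [R] has
   the [k]-sum property; no [n] qualifies when that set is empty. *)
Definition is_min_n_sum (R : nzRingType) (S : {pred R}) (n : nat) : Prop :=
  [/\ (0 < n)%N, n_sum_property S n
    & forall k, (0 < k)%N -> n_sum_property S k -> (n <= k)%N].

Definition additively_generated_by (R : finNzRingType) (S : {set R}) : Prop :=
  forall A : {set R}, zmod_closed A -> S \subset A -> A = [set: R].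

Definition cayley_adj (R : nzRingType) (S : {pred R}) : rel R :=
  fun a b => a - b \in S.

Definition graph_connected (T : finType) (e : rel T) : Prop :=
  forall x y : T, connect e x y.

Section NormOneUnits.

Variables (F : finFieldType) (L : fieldExtType F).

(* [finvect_type L] is [L] itself, carrying the finite and splitting field
   structures that every finite extension of the finite field [F] has. *)
Local Notation fL := (finvect_type L).

(* The norm of L / F, with values in the copy [1%VS] of [F] inside [L]; every
   extension of finite fields is Galois, so it is the product of conjugates. *)
Definition ext_norm : fL -> fL := galNorm 1 {:fL}.

Definition norm_one_units : {set fL} :=
  [set u : fL | (u != 0) && (ext_norm u == 1)].

Definition pm_norm_one_units : {set fL} :=
  norm_one_units :|: [set - u | u in norm_one_units].

Definition is_m (n : nat) : Prop :=
  is_min_n_sum (mem pm_norm_one_units) n.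

End NormOneUnits.

(* Main.v *)
Require Import Defs.
From mathcomp Require Import cyclic zify ring.

Set Implicit Arguments.
Unset Strict Implicit.
Unset Printing Implicit Defensive.

Import Order.TTheory GRing.Theory Num.Theory.
Local Open Scope ring_scope.

(** Write [q] for the order of [F] and [n] for the degree.  The norm is the power
    map [y |-> y ^+ m] with [m = 1 + q + ... + q ^ (n - 1)] (lemma [ext_normE]),
    so the norm-one elements form the group [U] of [m]-th roots of unity.  Since
    [u + v = u * (1 + v / u)], a nonzero [x] is a sum of two elements of [U] if
    and only if [x] and [1 + y] have the same norm for some [y] in [U].

    Degree at least three: two summands suffice.  If [n >= 4], view [u * u' + v =
    x * w], with all four letters in [U], as an incidence between the point
    [(u, v)] and the line of slope [- u'] and intercept [x * w].  A second-moment
    count shows that a large point set and a large line set in the affine plane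
    always meet ([incidence_bound]); this applies because [m ^ 4 > q ^ (3 * n)],
    and dividing by [w] expresses [x].  If [n = 3] that inequality fails, but
    norms of [y] and [1 + y] are the values at [0] and [-1], up to sign, of the
    minimal polynomial of [y] when [y] is not in [F].  Prescribing these two
    nonzero values leaves [q] monic cubics.  Neither [0] nor [-1] is a root of any
    of them and every other [r] in [F] is a root of exactly one, so some cubic has
    no root and is irreducible ([norm_shift_cubic]).

    Degree two: for [y] in [U], [1 + y] has norm [2 + t] where [t = y + y^-1] is
    the trace of [y].  If [q > 3], take [a] in [F] with [a] different from [0],
    [1] and [-1]: the trace value [a + a^-1] is not attained on [U], so some [x]
    is not a sum of two elements of [U] ([not_sum_two_norm_one]).  Every nonzero
    [x] is a sum of three, because the norm-one elements, and likewise the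
    elements of norm [x ^+ q.+1], take more than [q / 2] traces, so two such sets
    of traces inside [F] meet even after a reflection
    ([sum_three_norm_one]).  Finally [0] is a sum of three elements of [U] exactly
    when [y ^+ 2 + y + 1] has a root in [U], that is when [q] is not [1] modulo
    [3] ([zero_sum_three_norm_one]); this decides between [3] and [4]. *)

(** * Roots and powers in a finite field *)

(** This is what makes [x |-> x ^+ q] additive on a field with [q ^ n] elements. *)
Lemma pnat_card_root (L : finFieldType) (q n : nat) :
  (0 < n)%N -> #|L| = (q ^ n)%N -> [pchar L].-nat q.
Proof.
move=> n_gt0 cardL; have [p p_pr pcharLp] := finPcharP L.
have: [pchar L].-nat (q ^ n)%N.
  rewrite (eq_pnat _ (pcharf_eq pcharLp)) -cardL (card_pprimeChar pcharLp).
  by rewrite pnatX pnat_id.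
by rewrite pnatX eqn0Ngt n_gt0 orbF.
Qed.

Lemma card_roots_le (L : finFieldType) (p : {poly L}) :
  p != 0 -> (#|[set x | root p x]| < size p)%N.
Proof.
move=> p_neq0; rewrite cardE; apply: max_poly_roots => //; last exact: enum_uniq.
by apply/allP=> x; rewrite mem_enum inE.
Qed.

Lemma size_XnsubX (L : finFieldType) (n : nat) :
  (1 < n)%N -> size ('X^n - 'X : {poly L}) = n.+1.
Proof.
by move=> n_gt1; rewrite size_polyDl size_polyXn // size_polyN size_polyX ltnS.
Qed.

(** Both [p] and its cofactor in ['X^#|L| - 'X] have at most as many roots as
    their degree, while together they vanish on the whole field; hence neither
    bound can be strict. *)
Lemma card_roots_dvd (L : finFieldType) (p : {poly L}) :
  p %| 'X^#|L| - 'X -> #|[set x | root p x]| = (size p).-1.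
Proof.
move=> p_dvd; have XnX_size := size_XnsubX L (finNzRing_gt1 L).
have XnX_neq0 : 'X^#|L| - 'X != 0 :> {poly L}.
  by rewrite -size_poly_gt0 XnX_size.
have defXnX := divpK p_dvd; set r := _ %/ p in defXnX.
have /andP[r_neq0 p_neq0] : (r != 0) && (p != 0).
  by rewrite -negb_or -mulf_eq0 defXnX.
have ltp := card_roots_le p_neq0; have ltr := card_roots_le r_neq0.
have cover : (#|L| <= #|[set x | root r x]| + #|[set x | root p x]|)%N.
  rewrite -cardsT (leq_trans _ (leq_card_setU _ _)) // subset_leq_card //.
  apply/subsetP=> x _; rewrite !inE -rootM defXnX rootE !hornerE.
  by rewrite expf_card subrr.
have := size_mul r_neq0 p_neq0; rewrite defXnX XnX_size.
move: ltp ltr cover.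
move: (size p) (size r) #|[set x | root p x]| #|[set x | root r x]| #|L|.
by clear; lia.
Qed.

(** Used both to count norm-one elements and to see that every admissible value
    [c] is attained by the power map. *)
Lemma card_expf_eq (L : finFieldType) (m k : nat) (c : L) :
    (m * k = #|L|.-1)%N -> c ^+ k = 1 ->
  #|[set z | z ^+ m == c]| = m.
Proof.
move=> mk ck1; have L_gt1 := finNzRing_gt1 L.
have m_gt0 : (0 < m)%N.
  by case: m mk => // /esym/eqP; rewrite mul0n -subn1 subn_eq0 leqNgt L_gt1.
have sizeXmc : size ('X^m - c%:P) = m.+1 by rewrite size_XnsubC.
have -> : [set z | z ^+ m == c] = [set z | root ('X^m - c%:P) z].
  by apply/setP=> z; rewrite !inE rootE !hornerE subr_eq0.
rewrite card_roots_dvd ?sizeXmc //.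
have -> : 'X^#|L| - 'X = 'X * (('X^m) ^+ k - c%:P ^+ k) :> {poly L}.
  by rewrite -exprM mk -rmorphXn /= ck1 mulrBr mulr1 -exprS prednK // ltnW.
by rewrite dvdp_mull // subrXX dvdp_mulr.
Qed.

Lemma expf_card_pred (L : finFieldType) (x : L) : x != 0 -> x ^+ #|L|.-1 = 1.
Proof.
move=> x_neq0; apply: (mulfI x_neq0).
by rewrite -exprS mulr1 prednK ?expf_card // ltnW ?finNzRing_gt1.
Qed.

(** * Incidences between points and lines *)

(** A pair [l] encodes the line of slope [l.1] and intercept [l.2].  Each point
    lies on [Q = #|L|] lines and two points share at most one of them, so the
    number [I l] of points on [l] has mean [#|P| / Q] and small variance.  The
    lines that miss [P] each deviate from the mean by the full [#|P| / Q], hence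
    there cannot be many of them. *)
Lemma incidence_bound (L : finFieldType) (P Z : {set L * L}) :
    {in P & Z, forall p l, p.2 != l.1 * p.1 + l.2} ->
  (#|P| * #|Z| <= #|L| ^ 3)%N.
Proof.
move=> missing; set Q := #|L|.
pose inc (p l : L * L) : nat := p.2 == l.1 * p.1 + l.2.
pose I l : nat := (\sum_(p in P) inc p l)%N.
have card_line p : (\sum_l inc p l = Q)%N.
  rewrite -(pair_bigA _ (fun a b => inc p (a, b))) /=.
  rewrite /Q -sum1_card; apply: eq_bigr => a _.
  rewrite (bigD1 (p.2 - a * p.1)) //= {1}/inc /= addrC subrK eqxx.
  rewrite big1 // => b; apply: contraNeq; rewrite eqb0 negbK => /eqP->.
  by rewrite addrC addKr.
have two_points p p' : p != p' -> (\sum_l inc p l * inc p' l <= 1)%N.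
  move=> pp'; rewrite leqNgt; apply/negP=> two.
  pose D := [set l | (p.2 == l.1 * p.1 + l.2) && (p'.2 == l.1 * p'.1 + l.2)].
  have /card_gt1P[l [l' []]] : (1 < #|D|)%N.
    apply: leq_trans two _; rewrite -sum1_card [leqRHS]big_mkcond /=.
    by apply: leq_sum => l _; rewrite inE /inc mulnb; case: andb.
  rewrite !inE => /andP[/eqP e1 /eqP e2] /andP[/eqP e3 /eqP e4] ll'.
  have /eqP : (l.1 - l'.1) * (p.1 - p'.1) = 0.
    have -> : (l.1 - l'.1) * (p.1 - p'.1)
      = (l.1 * p.1 + l.2 - (l'.1 * p.1 + l'.2))
        - (l.1 * p'.1 + l.2 - (l'.1 * p'.1 + l'.2)) by ring.
    by rewrite -e1 -e2 -e3 -e4 !subrr.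
  rewrite mulf_eq0 !subr_eq0 => /orP[] /eqP e.
    case/negP: ll'; rewrite -pair_eqE /= e eqxx /=.
    by move: e1; rewrite e3 e => /addrI->.
  case/negP: pp'; rewrite -pair_eqE /= e eqxx /=.
  by rewrite e1 e2 e.
have sumI : (\sum_l I l = #|P| * Q)%N.
  by rewrite exchange_big -sum_nat_const; apply: eq_bigr => p _; apply: card_line.
have sumI2 : (\sum_l I l ^ 2 <= #|P| * Q + #|P| ^ 2)%N.
  have -> : (\sum_l I l ^ 2 = \sum_(p in P) \sum_(p' in P) \sum_l inc p l * inc p' l)%N.
    under [RHS]eq_bigr => p _ do rewrite exchange_big /=.
    rewrite [RHS]exchange_big /=; apply: eq_bigr => l _.
    by rewrite -mulnn big_distrl /=; apply: eq_bigr => p _; rewrite big_distrr.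
  rewrite expnS expn1 -mulnDr -sum_nat_const; apply: leq_sum => p Pp.
  rewrite (bigD1 p) //= leq_add //.
    by rewrite -(card_line p); apply: leq_sum => l _; rewrite mulnb andbb.
  apply: (@leq_trans (\sum_(p' in P | p' != p) 1)%N).
    by apply: leq_sum => p' /andP[_ p'p]; apply: two_points; rewrite eq_sym.
  by rewrite sum1_card subset_leq_card //; apply/subsetP=> p' /andP[].
(* The variance is multiplied by [Q ^+ 2] to stay among the integers. *)
have variance : (\sum_l (Q%:R * (I l)%:R - #|P|%:R) ^+ 2 <= #|P|%:R * Q%:R ^+ 3 :> int).
  have -> : \sum_l (Q%:R * (I l)%:R - #|P|%:R) ^+ 2
     = Q%:R ^+ 2 * (\sum_l I l ^ 2)%N%:R - 2 * Q%:R * #|P|%:R * (\sum_l I l)%N%:R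
       + Q%:R ^+ 2 * #|P|%:R ^+ 2 :> int.
    rewrite !natr_sum !mulr_sumr -sumrN -big_split /=.
    have -> : Q%:R ^+ 2 * #|P|%:R ^+ 2 = \sum_(l : L * L) #|P|%:R ^+ 2 :> int.
      by rewrite sumr_const card_prod -[RHS]mulr_natl natrM -expr2.
    by rewrite -big_split /=; apply: eq_bigr => l _; rewrite natrX; ring.
  rewrite sumI natrM.
  move: sumI2; rewrite -(ler_nat int) natrD natrM natrX.
  move/(ler_wpM2l (sqr_ge0 (Q%:R : int))) => le.
  apply: le_trans (lerD (lerB le (lexx _)) (lexx _)) _.
  by rewrite le_eqVlt; apply/orP; left; apply/eqP; ring.
have : (#|P|%:R ^+ 2 * #|Z|%:R <= #|P|%:R * Q%:R ^+ 3 :> int).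
  apply: le_trans variance; rewrite (bigID [in Z]) /= -[leLHS]addr0.
  apply: lerD; last by apply: sumr_ge0 => l _; apply: sqr_ge0.
  rewrite (eq_bigr (fun=> #|P|%:R ^+ 2)); first by rewrite sumr_const mulr_natr.
  move=> l Zl; rewrite /I big1 ?mulr0 ?sub0r ?sqrrN // => p Pp.
  by apply/eqP; rewrite eqb0; apply: missing.
rewrite -!natrX -!natrM ler_nat expnS expn1 -mulnA.
by case: (posnP #|P|) => [-> // | P_gt0]; rewrite leq_pmul2l.
Qed.

(** The equation is homogenised to [u * u' + v = x * w]: the extra factors [u']
    and [w] turn one equation into a family of [m ^ 2] points and [m ^ 2] lines. *)
Lemma sum_two_unity_roots (L : finFieldType) (m k : nat) (x : L) :
    (m * k = #|L|.-1)%N -> (#|L| ^ 3 < m ^ 4)%N -> x != 0 ->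
  exists u v : L, [/\ u ^+ m = 1, v ^+ m = 1 & x = u + v].
Proof.
move=> mk big_m x_neq0; pose U := [set u : L | u ^+ m == 1].
have cardU : #|U| = m by apply: card_expf_eq mk (expr1n _ _).
pose P := setX U U; pose Z := setX [set - u | u in U] [set x * w | w in U].
have cardP : #|P| = (m * m)%N by rewrite cardsX cardU.
have cardZ : #|Z| = (m * m)%N.
  by rewrite cardsX (card_imset _ oppr_inj) (card_imset _ (mulfI x_neq0)) cardU.
have [/existsP[p /existsP[l /and3P[]]] | none] :=
  boolP [exists p, exists l, [&& p \in P, l \in Z & p.2 == l.1 * p.1 + l.2]].
  case: p l => [u v] [a b]; rewrite !inE /= => /andP[/eqP u1 /eqP v1].
  case/andP=> /imsetP[u' + ->] /imsetP[w + ->] /eqP vE.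
  rewrite !inE => /eqP u'1 /eqP w1.
  have w_neq0 : w != 0.
    apply: contra_eq_neq w1 => ->; rewrite expr0n eq_sym.
    case: m big_m {mk U cardU P Z cardP cardZ u1 v1 u'1} => //= m _.
    by rewrite oner_neq0.
  exists (u' * u / w), (v / w); rewrite !exprMn exprVn u'1 u1 v1 w1 invr1 !mulr1.
  by split=> //; rewrite vE; field.
suff : (m ^ 4 <= #|L| ^ 3)%N by rewrite leqNgt big_m.
have -> : (m ^ 4 = #|P| * #|Z|)%N by rewrite cardP cardZ mulnn expnMn -expnD.
apply: incidence_bound => p l Pp Zl; apply: contraNneq none => e.
by apply/existsP; exists p; apply/existsP; exists l; rewrite Pp Zl -e eqxx.
Qed.

(** * Irreducible cubics with prescribed values at 0 and -1 *)

(** The class of ['X] in the field [F[X] / (h)], which has as many elements as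
    [L], is fixed by the power [#|L|]; so [h] divides ['X^#|L| - 'X], which splits
    in [L]. *)
Lemma irreducible_root (F L : finFieldType) (iota : {rmorphism F -> L})
    (h : {poly F}) :
    irreducible_poly h -> h \is monic -> #|L| = (#|F| ^ (size h).-1)%N ->
  exists y, root (map_poly iota h) y.
Proof.
move=> h_irr h_mon cardL.
have hI : monic_irreducible_poly h by split.
have h_dvd : h %| 'X^#|L| - 'X.
  have : in_qpoly h ('X^#|L| - 'X) = 0.
    rewrite rmorphB rmorphXn /= cardL -(card_qfpoly hI).
    by rewrite (expf_card (in_qpoly h 'X : {poly %/ h with hI})) subrr.
  move/(congr1 val); rewrite /= (mk_monicE hI) => /eqP.
  by rewrite /dvdp Pdiv.IdomainMonic.modpE.
have /card_roots_dvd : map_poly iota h %| 'X^#|L| - 'X.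
  have -> : 'X^#|L| - 'X = map_poly iota ('X^#|L| - 'X).
    by rewrite rmorphB /= map_polyXn map_polyX.
  by rewrite dvdp_map.
rewrite size_map_poly => card_roots.
have /card_gt0P[y] : (0 < #|[set y | root (map_poly iota h) y]|)%N.
  by rewrite card_roots -subn1 subn_gt0; case: h_irr.
by rewrite inE; exists y.
Qed.

(** An equation of degree [#|F|] has at most [#|F|] solutions, and the image of [F]
    already provides that many. *)
Lemma frobenius_fixed (F L : finFieldType) (iota : {rmorphism F -> L}) (x : L) :
  x ^+ #|F| = x -> exists a, x = iota a.
Proof.
move=> xq; suff /imsetP[a _ ->] : x \in [set iota a | a in F] by exists a.
have F_gt1 := finNzRing_gt1 F; pose p : {poly L} := 'X^#|F| - 'X.
have p_size : size p = #|F|.+1 by apply: size_XnsubX.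
have -> : [set iota a | a in F] = [set z | root p z].
  apply/eqP; rewrite eqEcard card_imset; last exact: fmorph_inj.
  rewrite -ltnS -p_size card_roots_le -?size_poly_gt0 ?p_size // andbT.
  apply/subsetP=> _ /imsetP[a _ ->]; rewrite inE rootE !hornerE.
  by rewrite -rmorphXn expf_card subrr.
by rewrite inE rootE !hornerE xq subrr.
Qed.

Lemma horner_frobenius (F L : finFieldType) (iota : {rmorphism F -> L})
    (p : {poly F}) (y : L) :
    [pchar L].-nat #|F| ->
  (map_poly iota p).[y ^+ #|F|] = (map_poly iota p).[y] ^+ #|F|.
Proof.
move=> q_nat; elim/poly_ind: p => [|p a IHp].
  by rewrite rmorph0 !horner0 expr0n -(prednK (ltnW (finNzRing_gt1 F))).
rewrite rmorphD rmorphM /= map_polyX map_polyC !hornerE IHp.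
by rewrite exprDn_pchar // exprMn -rmorphXn expf_card.
Qed.

(** Frobenius permutes the roots and fixes none of them, since a fixed root would
    lie in [F]; as its cube is the identity of [L], the orbit of [y] consists of
    three distinct roots. *)
Lemma cubic_conjugates (F L : finFieldType) (iota : {rmorphism F -> L})
    (h : {poly F}) (y : L) :
    #|L| = (#|F| ^ 3)%N -> size h = 4%N -> h \is monic ->
    (forall r, ~~ root h r) -> root (map_poly iota h) y ->
  map_poly iota h =
    ('X - y%:P) * ('X - (y ^+ #|F|)%:P) * ('X - (y ^+ #|F| ^+ #|F|)%:P).
Proof.
move=> cardL h_size h_mon h_noroot hy; set q := #|F|.
have q_nat : [pchar L].-nat q by apply: pnat_card_root cardL.
have conj z : root (map_poly iota h) z -> root (map_poly iota h) (z ^+ q).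
  rewrite !rootE horner_frobenius // => /eqP->.
  by rewrite expr0n -(prednK (ltnW (finNzRing_gt1 F))).
have moved z : root (map_poly iota h) z -> z ^+ q != z.
  move=> hz; apply/eqP => /(frobenius_fixed iota)[r zr].
  by move: hz; rewrite zr rootE horner_map fmorph_eq0 -rootE (negPf (h_noroot r)).
have y3 : y ^+ q ^+ q ^+ q = y.
  by rewrite -!exprM mulnA -[RHS]expf_card cardL !expnS mulnA muln1.
rewrite [LHS](all_roots_prod_XsubC (rs := [:: y; y ^+ q; y ^+ q ^+ q])).
- by rewrite (monicP (monic_map iota h_mon)) scale1r !big_cons big_nil mulr1 mulrA.
- by rewrite size_map_poly h_size.
- by rewrite /= hy !conj.
have y_yq : y != y ^+ q by rewrite eq_sym moved.
have yq_yqq : y ^+ q != y ^+ q ^+ q by rewrite eq_sym moved ?conj.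
have y_yqq : y != y ^+ q ^+ q.
  by apply: contraNneq (moved _ hy) => e; rewrite {1}e y3.
by rewrite uniq_rootsE /= !inE negb_or y_yq y_yqq yq_yqq.
Qed.

(** The sought [y] is a root of ['X^3 + t 'X^2 + (t + c - 2) 'X - 1].  This is the
    general monic cubic with values [-1] at [0] and [- c] at [-1]; these values
    are the opposites of the norms of [y] and of [1 + y]. *)
Lemma norm_shift_cubic (F L : finFieldType) (iota : {rmorphism F -> L}) (c : F) :
    #|L| = (#|F| ^ 3)%N -> c != 0 ->
  exists y : L, y ^+ (\sum_(i < 3) #|F| ^ i)%N = 1
    /\ (1 + y) ^+ (\sum_(i < 3) #|F| ^ i)%N = iota c.
Proof.
move=> cardL c_neq0; set q := #|F|.
have normE z : z ^+ (\sum_(i < 3) q ^ i)%N = z * z ^+ q * z ^+ q ^+ q :> L.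
  by rewrite !big_ord_recr big_ord0 /= add0n expn0 expn1 -mulnn !exprD expr1 exprM.
pose h t : {poly F} := Poly [:: -1; t + c - 2; t; 1].
have h_seq t : h t = [:: -1; t + c - 2; t; 1] :> seq F.
  by rewrite /h (PolyK (c := 0)) //= oner_neq0.
have hE t r : (h t).[r] = r ^+ 3 + t * r ^+ 2 + (t + c - 2) * r - 1.
  by rewrite horner_Poly /=; ring.
(* [T r] is the only parameter [t] for which [r] can be a root of [h t]; there are
   fewer nonzero [r] than parameters. *)
pose T (r : F) : F := - (r ^+ 3 + (c - 2) * r - 1) / (r ^+ 2 + r).
have [t tT] : exists t, t \notin [set T r | r in [set~ 0]].
  apply/existsP; rewrite -negb_forall; apply/forallP => allT.
  have : (q <= #|[set~ 0%R : F]|)%N.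
    apply: leq_trans (leq_imset_card T _); rewrite /q -cardsT subset_leq_card //.
    by apply/subsetP=> t _; apply: allT.
  by rewrite cardsC1 -/q leqNgt prednK ?leqnn // ltnW ?finNzRing_gt1.
have h_noroot r : ~~ root (h t) r.
  rewrite rootE hE; have [->|r_neq0] := eqVneq r 0.
    by rewrite !expr0n !mulr0 !add0r oppr_eq0 oner_neq0.
  have [->|r1_neq0] := eqVneq r (-1).
    have -> : (-1) ^+ 3 + t * (-1) ^+ 2 + (t + c - 2) * -1 - 1 = - c by ring.
    by rewrite oppr_eq0.
  apply: contra tT => /eqP hr; apply/imsetP; exists r; first by rewrite !inE.
  rewrite /T; have d_neq0 : r ^+ 2 + r != 0.
    by rewrite -[X in _ + X]mulr1 expr2 -mulrDr mulf_neq0 // addr_eq0.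
  apply: (mulIf d_neq0); rewrite divfK //.
  by apply/eqP; rewrite -subr_eq0 -hr; apply/eqP; ring.
have h_size : size (h t) = 4%N by rewrite h_seq.
have h_mon : h t \is monic by rewrite monicE lead_coefE h_size h_seq.
have h_irr : irreducible_poly (h t) by apply: cubic_irreducible; rewrite ?h_size.
have [y hy] : exists y, root (map_poly iota (h t)) y.
  by apply: irreducible_root; rewrite ?h_size.
have prodE z : (z - y) * (z - y ^+ q) * (z - y ^+ q ^+ q) = (map_poly iota (h t)).[z].
  by rewrite (cubic_conjugates cardL h_size h_mon h_noroot hy) !hornerE.
have q_nat : [pchar L].-nat q by apply: pnat_card_root cardL.
exists y; rewrite !normE; split; apply: oppr_inj.
  transitivity ((0 - y) * (0 - y ^+ q) * (0 - y ^+ q ^+ q)); first by ring.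
  by rewrite prodE -(rmorph0 iota) horner_map hE !expr0n !mulr0 !add0r rmorphN1.
rewrite !exprDn_pchar ?expr1n //.
transitivity ((-1 - y) * (-1 - y ^+ q) * (-1 - y ^+ q ^+ q)); first by ring.
by rewrite prodE -(rmorphN1 iota) horner_map hE -rmorphN; congr (iota _); ring.
Qed.

(** * Extensions of degree at least three *)

Lemma sum_two_norm_one (F L : finFieldType) (iota : {rmorphism F -> L})
    (n : nat) (x : L) (m := (\sum_(i < n) #|F| ^ i)%N) :
    (2 < n)%N -> #|L| = (#|F| ^ n)%N -> x != 0 ->
  exists u v : L, [/\ u ^+ m = 1, v ^+ m = 1 & x = u + v].
Proof.
move=> n_gt2 cardL x_neq0; have F_gt1 := finNzRing_gt1 F.
have mq : (m * #|F|.-1 = #|L|.-1)%N by rewrite cardL predn_exp mulnC.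
move: n_gt2; rewrite leq_eqVlt => /orP[/eqP n3 | n_gt3]; last first.
  apply: (sum_two_unity_roots mq) => //; rewrite cardL -expnM.
  (* [m > q ^ (n - 1)], and [4 * (n - 1) >= 3 * n] exactly when [n >= 4]. *)
  apply: (@leq_ltn_trans ((#|F| ^ n.-1) ^ 4)).
    by rewrite -expnM leq_exp2l //; lia.
  rewrite ltn_exp2r // /m.
  case: n n_gt3 {cardL m mq} => [|[|n]] // _.
  rewrite big_ord_recr /= -[ltnLHS]add0n ltn_add2r big_ord_recr /= addn_gt0.
  by rewrite expn_gt0 (ltnW F_gt1) orbT.
have [c xm] : exists c, x ^+ m = iota c.
  apply: (frobenius_fixed iota).
  by rewrite -(prednK (ltnW F_gt1)) exprS -exprM mq expf_card_pred ?mulr1.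
have c_neq0 : c != 0 by rewrite -(fmorph_eq0 iota) -xm expf_neq0.
have [y [ym y1m]] : exists y : L, y ^+ m = 1 /\ (1 + y) ^+ m = iota c.
  by rewrite /m -n3; apply: norm_shift_cubic; rewrite ?n3.
have m_gt0 : (0 < m)%N by rewrite /m -n3 !big_ord_recr /= big_ord0.
have y1_neq0 : 1 + y != 0.
  apply: contraNneq c_neq0 => y1.
  by rewrite -(fmorph_eq0 iota) -y1m y1 expr0n -(prednK m_gt0).
have um : (x / (1 + y)) ^+ m = 1.
  by rewrite exprMn exprVn xm y1m divff // fmorph_eq0.
exists (x / (1 + y)), (x / (1 + y) * y); split=> //; last by field.
by rewrite exprMn um mul1r.
Qed.

(** * Norm-one elements of a quadratic extension *)

Section Quadratic.

Variables (L : finFieldType) (q : nat).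
Hypothesis cardL : #|L| = (q ^ 2)%N.

Lemma quadratic_base_gt1 : (1 < q)%N.
Proof. by have := finNzRing_gt1 L; rewrite cardL; case: q => [|[]]. Qed.

Lemma quadratic_cardP : (q.+1 * q.-1 = #|L|.-1)%N.
Proof. by rewrite cardL predn_exp 2!big_ord_recr big_ord0 /= expn1 mulnC. Qed.

Lemma quadratic_frobeniusD (x y : L) : (x + y) ^+ q = x ^+ q + y ^+ q.
Proof. by apply: exprDn_pchar; apply: pnat_card_root cardL. Qed.

Lemma quadratic_frobeniusK (x : L) : x ^+ q ^+ q = x.
Proof. by rewrite -exprM mulnn -cardL expf_card. Qed.

(** For odd [q] the exponent is even, and for even [q] the signs do not matter;
    additivity of Frobenius treats both cases at once. *)
Lemma quadratic_normN1 : (-1) ^+ q.+1 = 1 :> L.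
Proof.
have q_gt0 := ltnW quadratic_base_gt1.
have /eqP := quadratic_frobeniusD (-1) 1.
rewrite addNr expr1n expr0n -(prednK q_gt0) /= prednK //.
by rewrite eq_sym addr_eq0 exprS mulN1r => /eqP->; rewrite opprK.
Qed.

(** The [q.+1] elements of norm [c] are roots of the polynomials
    ['X^2 - t 'X + c], where [t] is their trace, so no trace is taken three times. *)
Lemma card_trace_norm (c : L) :
  c ^+ q = c -> c != 0 ->
  (q < #|[set z + z ^+ q | z : L in [set z | z ^+ q.+1 == c]]%R| * 2)%N.
Proof.
move=> cq c_neq0; pose N := [set z : L | z ^+ q.+1 == c].
have cardN : #|N| = q.+1.
  apply: card_expf_eq quadratic_cardP _; apply: (mulfI c_neq0).
  by rewrite -exprS mulr1 prednK // ltnW ?quadratic_base_gt1.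
apply: (@leq_trans #|N|); first by rewrite cardN.
rewrite -/N -sum1_card (partition_big_imset (fun z => z + z ^+ q)) /=.
rewrite -sum_nat_const; apply: leq_sum => t _; rewrite sum1dep_card.
have p_size : size ('X^2 + (c%:P - t *: 'X) : {poly L}) = 3%N.
  rewrite size_polyDl size_polyXn // (leq_ltn_trans (size_polyD _ _)) //.
  rewrite gtn_max size_polyN (leq_ltn_trans (size_polyC_leq1 _)) //.
  by rewrite (leq_ltn_trans (size_scale_leq _ _)) ?size_polyX.
apply: leq_trans (_ : #|[set z | root ('X^2 + (c%:P - t *: 'X)) z]| <= 2)%N; last first.
  by rewrite -ltnS -p_size card_roots_le // -size_poly_gt0 p_size.
apply/subset_leq_card/subsetP => z; rewrite !inE => /andP[/eqP zm /eqP zt].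
rewrite rootE hornerD hornerD hornerN hornerZ hornerXn hornerX hornerC.
by rewrite -zt -zm (exprS z q); apply/eqP; ring.
Qed.

(** With [c] the norm of [x], it suffices to find [z] of norm [c] such that [1 - z]
    has the norm of [1 + y] for some norm-one [y]: then [1 - z] is a sum of two
    norm-one elements, and [x / z] has norm one.  The condition reads
    [c - 1 - tr z = tr y].  Both sides range over subsets of the subfield [K] with
    more than [q / 2] elements, so they have a common value. *)
Lemma sum_three_norm_one (x : L) : x != 0 ->
  exists u v w : L,
    [/\ u ^+ q.+1 = 1, v ^+ q.+1 = 1, w ^+ q.+1 = 1 & x = u + v + w].
Proof.
move=> x_neq0; pose c := x ^+ q.+1.
have c_neq0 : c != 0 by apply: expf_neq0.
have cq : c ^+ q = c by rewrite /c exprS exprMn quadratic_frobeniusK mulrC.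
pose T (a : L) : {set L} := [set z + z ^+ q | z : L in [set z | z ^+ q.+1 == a]].
pose K := [set z : L | z ^+ q == z].
have T_K a : T a \subset K.
  apply/subsetP=> _ /imsetP[z _ ->].
  by rewrite inE quadratic_frobeniusD quadratic_frobeniusK addrC.
have frobN z : (- z) ^+ q = - z ^+ q :> L.
  apply/eqP; rewrite -addr_eq0 -quadratic_frobeniusD addNr expr0n.
  by rewrite -(prednK (ltnW quadratic_base_gt1)).
have B_K : [set c - 1 - s | s in T c] \subset K.
  apply/subsetP=> _ /imsetP[s /(subsetP (T_K c)) + ->]; rewrite !inE => /eqP sq.
  by rewrite !quadratic_frobeniusD !frobN expr1n sq cq.
have cardK : (#|K| <= q)%N.
  have p_size := size_XnsubX L quadratic_base_gt1.
  rewrite -ltnS -p_size (leq_trans _ (card_roots_le (p := 'X^q - 'X) _)) //.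
    rewrite ltnS subset_leq_card //; apply/subsetP=> z.
    by rewrite !inE rootE !hornerE subr_eq0.
  by rewrite -size_poly_gt0 p_size.
have [t] : exists t, t \in T 1 :&: [set c - 1 - s | s in T c].
  apply/set0Pn; apply: contraTneq cardK => disj; rewrite -ltnNge.
  have cardB : #|[set c - 1 - s | s in T c]| = #|T c|.
    by apply: card_imset => s s' /addrI/oppr_inj.
  have := card_trace_norm (expr1n _ _) (oner_neq0 _); have := card_trace_norm cq c_neq0.
  rewrite -/(T c) -/(T 1).
  have : (#|T 1%R| + #|T c| <= #|K|)%N.
    have := leq_card_setU (T 1) [set c - 1 - s | s in T c].
    rewrite -setI_eq0 disj eqxx => -[_ /eqP eq_card].
    by rewrite -cardB -eq_card subset_leq_card // subUset T_K B_K.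
  move: #|T 1| #|T c| #|K|; lia.
rewrite inE => /andP[/imsetP[y + ->] /imsetP[s /imsetP[z + ->]]].
rewrite !inE => /eqP ym /eqP zm e.
have z_neq0 : z != 0.
  by apply: contraNneq c_neq0 => z0; rewrite -zm z0 expr0n.
have gm : (x / z) ^+ q.+1 = 1 by rewrite exprMn exprVn zm divff.
have norm_eq : (1 + y) ^+ q.+1 = (1 - z) ^+ q.+1.
  rewrite !exprS !quadratic_frobeniusD frobN expr1n.
  rewrite !mulrDl !mulrDr !mul1r !mulr1 mulrN mulNr opprK -!exprS ym zm.
  transitivity (2 + (y + y ^+ q)); first by ring.
  by rewrite e; ring.
have [y1|y1_neq0] := eqVneq (1 + y) 0.
  have z1 : z = 1.
    have : (1 - z) ^+ q.+1 == 0 by rewrite -norm_eq y1 expr0n.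
    by rewrite expf_eq0 subr_eq0 => /eqP.
  exists (x / z), 1, (-1); rewrite expr1n quadratic_normN1 gm; split=> //.
  by rewrite z1 divr1 addrK.
pose w := (1 - z) / (1 + y).
have wm : w ^+ q.+1 = 1 by rewrite exprMn exprVn norm_eq divff // -norm_eq expf_neq0.
have mul1 a b : a ^+ q.+1 = 1 -> b ^+ q.+1 = 1 -> (a * b) ^+ q.+1 = 1 :> L.
  by move=> a1 b1; rewrite exprMn a1 b1 mulr1.
exists (x / z), (- 1 * (x / z * w)), (- 1 * (x / z * (w * y))).
split=> //.
- exact: mul1 quadratic_normN1 (mul1 _ _ gm wm).
- exact: mul1 quadratic_normN1 (mul1 _ _ gm (mul1 _ _ wm ym)).
by rewrite /w; field; rewrite y1_neq0.
Qed.

(** Take [a] in the subfield with [a ^+ 2 != 1] and [x] of norm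
    [(1 + a) ^+ 2 / a = 2 + a + a^-1].  If [x = u + v] then [y = v / u] satisfies
    [y + y^-1 = a + a^-1], whence [y] is [a] or [a^-1] and lies in the subfield;
    but there the norm is the square, so [a ^+ 2 = 1]. *)
Lemma not_sum_two_norm_one :
  (3 < q)%N ->
  exists x : L, forall u v : L, u ^+ q.+1 = 1 -> v ^+ q.+1 = 1 -> x != u + v.
Proof.
move=> q_gt3.
have qq : (q.-1 * q.+1 = #|L|.-1)%N by rewrite mulnC quadratic_cardP.
have [a aq a2] : exists2 a : L, a ^+ q.-1 = 1 & a ^+ 2 != 1.
  have q_pred : (2 < #|[set a : L | a ^+ q.-1 == 1]%R|)%N.
    by rewrite (card_expf_eq qq (expr1n _ _)) -ltnS (ltn_predK q_gt3).
  have sq_le : (#|[set a : L | a ^+ 2 == 1]%R| <= 2)%N.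
    have p_size : size ('X^2 - 1%:P : {poly L}) = 3%N by rewrite size_XnsubC.
    rewrite -ltnS -p_size (leq_trans _ (card_roots_le (p := 'X^2 - 1%:P) _)) //.
      rewrite ltnS subset_leq_card //; apply/subsetP=> z.
      by rewrite !inE rootE !hornerE subr_eq0.
    by rewrite -size_poly_gt0 p_size.
  have /subsetPn[a] :
      ~~ ([set a : L | a ^+ q.-1 == 1] \subset [set a : L | a ^+ 2 == 1]).
    by apply: contraL q_pred => /subset_leq_card le; rewrite -leqNgt (leq_trans le).
  by rewrite !inE => /eqP aq a2; exists a.
have a_neq0 : a != 0.
  apply: contra_eq_neq aq => ->.
  by rewrite expr0n -(subnKC q_gt3) eq_sym oner_eq0.
have a1_neq0 : 1 + a != 0.
  apply: contraNneq a2 => /eqP; rewrite addrC addr_eq0 => /eqP->.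
  by rewrite sqrrN expr1n.
have [x xm] : exists x : L, x ^+ q.+1 = (1 + a) ^+ 2 / a.
  have /card_gt0P[x] : (0 < #|[set z : L | z ^+ q.+1 == (1 + a) ^+ 2 / a]|)%N.
    rewrite (card_expf_eq quadratic_cardP) // exprMn exprVn aq invr1 mulr1 exprAC.
    have -> : (1 + a) ^+ q.-1 = 1.
      apply: (mulfI a1_neq0); rewrite -exprS mulr1 prednK ?quadratic_frobeniusD.
        by rewrite expr1n -[in LHS](prednK (ltnW quadratic_base_gt1)) exprS aq mulr1.
      exact: ltnW quadratic_base_gt1.
    by rewrite expr1n.
  by rewrite inE => /eqP; exists x.
exists x => u v um vm; apply: contraNneq a2 => xE.
have u_neq0 : u != 0 by apply: contra_eq_neq um => ->; rewrite expr0n eq_sym oner_eq0.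
pose y := v / u.
have ym : y ^+ q.+1 = 1 by rewrite exprMn exprVn um vm divr1.
have y_neq0 : y != 0 by apply: contra_eq_neq ym => ->; rewrite expr0n eq_sym oner_eq0.
have : (1 + y) ^+ 2 / y = (1 + a) ^+ 2 / a.
  rewrite -xm xE; have -> : u + v = u * (1 + y) by rewrite /y; field.
  rewrite exprMn um mul1r (exprS _ q) quadratic_frobeniusD expr1n.
  have -> : y ^+ q = y^-1 by apply: (mulfI y_neq0); rewrite -exprS ym divff.
  by field.
move/eqP; rewrite eqr_div // => /eqP e.
have /eqP : (y - a) * (y * a - 1) = 0.
  transitivity ((1 + y) ^+ 2 * a - (1 + a) ^+ 2 * y); first by ring.
  by rewrite e subrr.
have sq z : z ^+ q.-1 = 1 -> z ^+ q.+1 = 1 -> z ^+ 2 = 1 :> L.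
  by move=> zq; rewrite -(prednK (ltnW quadratic_base_gt1)) -addn2 exprD zq mul1r.
rewrite mulf_eq0 !subr_eq0 => /orP[/eqP ya | /eqP ya].
  by rewrite sq // -ya.
by rewrite sq // -[LHS]mul1r -ym -exprMn ya expr1n.
Qed.

End Quadratic.

(** * Sums of a fixed number of elements *)

Lemma n_sum_generates (R : finNzRingType) (S : {set R}) (n : nat) :
  n_sum_property (mem S) n -> additively_generated_by S.
Proof.
move=> sumS A [A0 AB] SA; apply/setP=> x; rewrite [RHS]inE.
have [s sS ->] := sumS x.
have AD y z : y \in A -> z \in A -> y + z \in A.
  move=> Ay Az; rewrite -[z]opprK AB //.
  by rewrite -sub0r AB.
rewrite big_seq; elim/big_ind: _ => // y ys.
by apply: (subsetP SA); apply: sS.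
Qed.

Lemma n_sum_connected (R : finNzRingType) (S : {set R}) (n : nat) :
    (forall u, u \in S -> - u \in S) ->
  n_sum_property (mem S) n -> graph_connected (cayley_adj (mem S)).
Proof.
move=> SN sumS x y; have [s sS yE] := sumS (y - x).
have {}sS : {subset tval s <= S} by [].
rewrite -[y](subrK x) {y}yE; elim: (tval s) sS => [|u t IHt] tS.
  by rewrite big_nil add0r.
apply: connect_trans (IHt _) (connect1 _).
  by move=> z zt; apply: tS; rewrite in_cons zt orbT.
have -> : cayley_adj (mem S) (\sum_(y <- t) y + x) (\sum_(y <- u :: t) y + x)
    = (- u \in S).
  by rewrite /cayley_adj big_cons; rewrite -(addrA u) opprD addrCA subrr addr0.
by apply/SN/tS; rewrite mem_head.
Qed.

Lemma not_one_sum (R : nzRingType) (S : {pred R}) :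
  0 \notin S -> ~ n_sum_property S 1.
Proof.
move=> S0 /(_ 0)[[[|a []] //= sz] aS]; rewrite big_seq1 => a0.
by case/negP: S0; rewrite a0 aS ?mem_head.
Qed.

Lemma n_sum2P (R : nzRingType) (S : {pred R}) :
  n_sum_property S 2 <-> forall x, exists u v, [/\ u \in S, v \in S & x = u + v].
Proof.
split=> [sumS x|sumS x].
  have [[[|u [|v []]] //= sz] sS ->] := sumS x.
  by exists u, v; rewrite !sS ?inE ?eqxx ?orbT // big_cons big_seq1.
have [u [v [uS vS ->]]] := sumS x; exists [tuple u; v].
  by move=> z; rewrite !inE => /orP[]/eqP->.
by rewrite big_cons big_seq1.
Qed.

Lemma n_sum3P (R : nzRingType) (S : {pred R}) :
  n_sum_property S 3 <->
  forall x, exists u v w, [/\ u \in S, v \in S, w \in S & x = u + v + w].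
Proof.
split=> [sumS x|sumS x].
  have [[[|u [|v [|w []]]] //= sz] sS ->] := sumS x.
  by exists u, v, w; rewrite !sS ?inE ?eqxx ?orbT // !big_cons big_nil addr0 addrA.
have [u [v [w [uS vS wS ->]]]] := sumS x; exists [tuple u; v; w].
  by move=> z; rewrite !inE => /or3P[]/eqP->.
by rewrite !big_cons big_nil addr0 addrA.
Qed.

(** * The minimal number of summands in degree two *)

Section QuadraticSums.

Variables (L : finFieldType) (q : nat).
Hypothesis cardL : #|L| = (q ^ 2)%N.
Local Notation U := [set u : L | u ^+ q.+1 == 1].
Let q_gt1 := quadratic_base_gt1 cardL.

Lemma quadratic_U0 : 0 \notin U.
Proof. by rewrite inE expr0n eq_sym oner_eq0. Qed.

Lemma quadratic_U1 : 1 \in U. Proof. by rewrite inE expr1n. Qed.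

Lemma quadratic_UN1 : -1 \in U.
Proof. by rewrite inE quadratic_normN1. Qed.

Lemma quadratic_UM u v : u \in U -> v \in U -> u * v \in U.
Proof. by rewrite !inE exprMn => /eqP-> /eqP->; rewrite mulr1. Qed.

Lemma quadratic_UV u : u \in U -> u^-1 \in U.
Proof. by rewrite !inE exprVn => /eqP->; rewrite invr1. Qed.

Lemma quadratic_frobeniusU u : u \in U -> u ^+ q = u^-1.
Proof.
move=> Uu; have u_neq0 : u != 0 by apply: contraTneq Uu => ->; apply: quadratic_U0.
by apply: (mulfI u_neq0); rewrite -exprS divff //; move: Uu; rewrite inE => /eqP.
Qed.

Lemma quadratic_dvd3 : (3 %| q)%N = (3%:R == 0 :> L).
Proof.
have q_nat : [pchar L].-nat q by apply: pnat_card_root cardL.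
apply/idP/eqP => [q3 | three0].
  have /pcharf0 // : 3%N \in [pchar L].
  by apply: (pnatPpi q_nat); rewrite mem_primes q3 ltnW.
have ch3 : 3%N \in [pchar L] by rewrite inE /= three0 eqxx.
move: q_nat; rewrite (eq_pnat _ (pcharf_eq ch3)) => /p_natP[[|k] qE].
  by move: q_gt1; rewrite qE.
by rewrite qE expnS dvdn_mulr.
Qed.

(** A vanishing sum [u + v + w] also has vanishing conjugate
    [u^-1 + v^-1 + w^-1]; together they force [y = v / u] to be a root of
    [y ^+ 2 + y + 1], hence [y ^+ 3 = 1].  When [q] is [1] modulo [3], the exponent
    [q.+1] is [2] modulo [3], leaving only [y = 1], which would need
    characteristic [3].  In the other cases a suitable [y] is [1] (characteristic
    [3]) or an element of order [3], available because [3] divides [q.+1]. *)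
Lemma zero_sum_three_norm_one :
  (exists u v w, [/\ u \in U, v \in U, w \in U & 0 = u + v + w]) <->
  (q %% 3 != 1)%N.
Proof.
split=> [[u [v [w [Uu Uv Uw sum0]]]]|].
  apply/negP => /eqP q1.
  have [u0 v0 w0] : [/\ u != 0, v != 0 & w != 0].
    by split; [move: Uu | move: Uv | move: Uw]; apply: contraTneq => ->;
       apply: quadratic_U0.
  pose y := v / u; have Uy : y \in U by rewrite quadratic_UM ?quadratic_UV.
  have conj0 : u^-1 + v^-1 + w^-1 = 0.
    rewrite -!quadratic_frobeniusU // -!(quadratic_frobeniusD cardL) -sum0.
    by rewrite expr0n -(prednK (ltnW q_gt1)).
  have y_root : y ^+ 2 + y + 1 = 0.
    have wE : w = - (u + v) by apply/eqP; rewrite -addr_eq0 addrC -sum0.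
    have uv0 : u + v != 0 by rewrite -oppr_eq0 -wE.
    (* Clear denominators in the conjugate sum, with [w = - (u + v)]. *)
    transitivity ((u^-1 + v^-1 + w^-1) * (v * (u + v) / u)).
      2: by rewrite conj0 mul0r.
    by rewrite wE /y; field; rewrite u0 v0 oppr_eq0 uv0.
  have y3 : y ^+ 3 = 1.
    apply/eqP; rewrite -subr_eq0; apply/eqP.
    by transitivity ((y - 1) * (y ^+ 2 + y + 1)); [ring | rewrite y_root mulr0].
  have y2 : y ^+ 2 = 1.
    have q1E : q.+1 = (3 * (q %/ 3) + 2)%N.
      by rewrite {1}(divn_eq q 3) q1 mulnC addn1 addn2.
    by move: Uy; rewrite inE q1E exprD exprM y3 expr1n mul1r => /eqP.
  have y1 : y = 1 by rewrite -y3 exprS y2 mulr1.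
  have : (3 %| q)%N by rewrite quadratic_dvd3 -y_root y1 expr1n; apply/eqP; ring.
  by rewrite /dvdn q1.
move=> q_neq1; suff [y Uy y0] : exists2 y, y \in U & 1 + y + y * y = 0.
  by exists 1, y, (y * y); rewrite quadratic_U1 quadratic_UM // Uy y0.
have [q3|q3] := boolP (3 %| q)%N.
  exists 1; rewrite ?quadratic_U1 //.
  by move: q3; rewrite quadratic_dvd3 => /eqP <-; ring.
have qS3 : (3 %| q.+1)%N.
  by rewrite /dvdn -addn1 -modnDml; move: q3 q_neq1 (ltn_pmod q (isT : 0 < 3)%N);
     rewrite /dvdn; case: (q %% 3)%N => [|[|[|]]].
have card3 : #|[set y : L | y ^+ 3 == 1]%R| = 3%N.
  apply: (@card_expf_eq _ _ (q.+1 %/ 3 * q.-1)); last exact: expr1n.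
  by rewrite mulnA [(3 * _)%N]mulnC divnK // (quadratic_cardP cardL).
have /subsetPn[y] : ~~ ([set y : L | y ^+ 3 == 1] \subset [set 1]).
  by apply/negP=> /subset_leq_card; rewrite card3 cards1.
rewrite !inE => /eqP y3 y1; exists y.
  by rewrite inE -(divnK qS3) mulnC exprM y3 expr1n.
have y1' : y - 1 != 0 by rewrite subr_eq0.
apply: (mulfI y1'); rewrite mulr0; transitivity (y ^+ 3 - 1); first by ring.
by rewrite y3 subrr.
Qed.

(** For [q = 2] every nonzero element has norm one.  For [q = 3] the norms are [1]
    and [-1]: in the first case [x = - x - x], and the second is represented by
    [1 + i] with [i ^+ 2 = -1]. *)
Lemma quadratic_min2 : q \in [:: 2; 3]%N -> is_min_n_sum (mem U) 2.
Proof.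
move=> q23; split=> // [|[|[|k]] // _ /not_one_sum[]]; last exact: quadratic_U0.
apply/n_sum2P => x; have [->|x0] := eqVneq x 0.
  by exists 1, (-1); rewrite quadratic_U1 quadratic_UN1 subrr.
have Upred : x ^+ #|L|.-1 = 1 by apply: expf_card_pred.
move: q23; rewrite !inE => /orP[] /eqP q_eq.
  have [u /andP[u0 ux]] : exists u : L, (u != 0) && (u != x).
    have /subsetPn[u _] : ~~ ([set: L] \subset [set 0; x]).
      apply/negP => /subset_leq_card; rewrite cardsT cardL q_eq cards2.
      by case: (_ != _).
    by rewrite !inE negb_or; exists u.
  have nzU y : y != 0 -> y \in U.
    by move=> /expf_card_pred; rewrite cardL q_eq inE => ->.
  exists u, (x - u); split; [exact: nzU | | by rewrite addrC subrK].
  by rewrite nzU // subr_eq0 eq_sym.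
have three0 : 3%:R = 0 :> L by apply/eqP; rewrite -quadratic_dvd3 q_eq.
have UE y : (y \in U) = (y ^+ 4 == 1) by rewrite inE q_eq.
have : (x ^+ 4 - 1) * (x ^+ 4 + 1) = 0.
  move: Upred; rewrite cardL q_eq => x8.
  by transitivity (x ^+ 8 - 1); [ring | rewrite x8 subrr].
move/eqP; rewrite mulf_eq0 subr_eq0 => /orP[x4 | /eqP x4].
  have Ux : x \in U by rewrite UE.
  exists (-1 * x), (-1 * x); rewrite quadratic_UM ?quadratic_UN1 //.
  split=> //; apply/eqP; rewrite -subr_eq0; apply/eqP.
  by transitivity (3%:R * x); [ring | rewrite three0 mul0r].
have [i i2] : exists i : L, i ^+ 2 = -1.
  have /card_gt0P[i] : (0 < #|[set i : L | i ^+ 2 == -1]%R|)%N.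
    by rewrite (@card_expf_eq _ 2 4) // ?cardL ?q_eq // -signr_odd.
  by rewrite inE => /eqP; exists i.
have i4 : (1 + i) ^+ 4 = -1.
  transitivity (i ^+ 2 * (i ^+ 2 + 4 * i + 6) + 4 * i + 1); first by ring.
  by rewrite i2; transitivity (3%:R * (-1) - 1 : L); [ring | rewrite three0; ring].
have i1 : 1 + i != 0.
  apply: contra_eq_neq i4 => ->; rewrite expr0n eq_sym oppr_eq0; exact: oner_neq0.
exists (x / (1 + i)), (x / (1 + i) * i); split; last by field.
- rewrite UE exprMn exprVn i4 invrN1 mulrN1.
  by move/eqP: x4; rewrite addr_eq0 => /eqP->; rewrite opprK.
- rewrite UE !exprMn exprVn i4 invrN1 mulrN1 (exprM i 2 2) i2 sqrrN expr1n mulr1.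
  by move/eqP: x4; rewrite addr_eq0 => /eqP->; rewrite opprK.
Qed.

Lemma quadratic_sum3 x : x != 0 ->
  exists u v w, [/\ u \in U, v \in U, w \in U & x = u + v + w].
Proof.
move=> /(sum_three_norm_one cardL)[u [v [w [u1 v1 w1 xE]]]].
by exists u, v, w; rewrite !inE u1 v1 w1 eqxx.
Qed.

Lemma quadratic_not_sum2 : (3 < q)%N -> ~ n_sum_property (mem U) 2.
Proof.
move=> /(not_sum_two_norm_one cardL)[x no] /n_sum2P/(_ x)[u [v []]].
rewrite !inE => /eqP u1 /eqP v1 xE.
by case/negP: (no u v u1 v1); rewrite xE.
Qed.

Lemma quadratic_min3 :
  (3 < q)%N -> (q %% 3 != 1)%N -> is_min_n_sum (mem U) 3.
Proof.
move=> q_gt3 q_mod; split=> // [|[|[|[|k]]] // _].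
- apply/n_sum3P => x; have [->|] := eqVneq x 0; last exact: quadratic_sum3.
  exact/zero_sum_three_norm_one.
- by move/not_one_sum => []; apply: quadratic_U0.
- by move/(quadratic_not_sum2 q_gt3).
Qed.

(** Four summands suffice because [x - a] is nonzero, hence a sum of three, for any
    norm-one [a] different from [x]. *)
Lemma quadratic_min4 : (q %% 3 = 1)%N -> is_min_n_sum (mem U) 4.
Proof.
move=> q_mod; have q_gt3 : (3 < q)%N.
  by move: q_mod q_gt1; clear; case: q => [|[|[|[|]]]].
have sum4 : n_sum_property (mem U) 4; last first.
  split=> // -[|[|[|[|k]]]] // _.
  - by move/not_one_sum => []; apply: quadratic_U0.
  - by move/(quadratic_not_sum2 q_gt3).
  - by move/n_sum3P/(_ 0)/zero_sum_three_norm_one; rewrite q_mod.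
move=> x.
suff [a [u [v [w [Ua Uu Uv Uw ->]]]]] : exists a u v w,
    [/\ a \in U, u \in U, v \in U, w \in U & x = a + (u + v + w)].
  exists [tuple a; u; v; w]; last by rewrite !big_cons big_nil addr0 !addrA.
  by move=> z zs; rewrite !inE in zs; case/or4P: zs => /eqP->.
have [-> | x0] := eqVneq x 0.
  exists 1, (-1), 1, (-1); rewrite quadratic_U1 quadratic_UN1; split=> //; ring.
have /subsetPn[a Ua] : ~~ (U \subset [set x]).
  apply/negP=> /subset_leq_card.
  by rewrite (card_expf_eq (quadratic_cardP cardL) (expr1n _ _)) cards1 ltnNge ltnW.
rewrite inE eq_sym -subr_eq0 => /quadratic_sum3[u [v [w [Uu Uv Uw e]]]].
by exists a, u, v, w; rewrite -e addrC subrK.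
Qed.

End QuadraticSums.

(** * The norm of a finite extension of finite fields *)

Lemma card_finvect (F : finFieldType) (L : fieldExtType F) :
  #|finvect_type L| = (#|F| ^ \dim {:L})%N.
Proof.
rewrite -(card_vspace {:finvect_type L}) -cardsT.
by apply: eq_card => x; rewrite inE memvf.
Qed.

(** The Galois group is cyclic, generated by the [#|F|]-power map, so the
    conjugates of [u] are its [#|F| ^ i]-th powers and the norm is one explicit
    power.  This turns every later question into one about roots of unity. *)
Lemma ext_normE (F : finFieldType) (L : fieldExtType F) (u : finvect_type L) :
  ext_norm u = u ^+ (\sum_(i < \dim {:L}) #|F| ^ i)%N.
Proof.
have [alpha /eqP gen Dalpha] :=
  finField_galois_generator (sub1v {:finvect_type L}).
have ord : #[alpha]%g = \dim {:L}.
  rewrite /order -gen -galois_dim ?finField_galois ?sub1v //.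
  by rewrite dimv1 divn1.
have alphaX i : (alpha ^+ i)%g u = u ^+ (#|F| ^ i).
  elim: i => [|i IHi]; first by rewrite expg0 gal_id expn0 expr1.
  by rewrite expgSr galM ?memvf // IHi Dalpha ?memvf // dimv1 expn1 -exprM -expnSr.
rewrite /ext_norm /galNorm gen expr_sum -ord.
have -> : <[alpha]>%g = [set (alpha ^+ val i)%g | i : 'I_#[alpha]%g].
  apply/setP=> x; apply/idP/imsetP => [/cyclePmin[i lt_i ->]|[i _ ->]].
    by exists (Ordinal lt_i).
  exact: mem_cycle.
rewrite big_imset /= => [|i j _ _ /eqP].
  by apply: eq_bigr => i _; apply: alphaX.
by rewrite eq_expg_mod_order !modn_small ?ltn_ord // => /eqP/val_inj.
Qed.

Lemma norm_one_unitsE (F : finFieldType) (L : fieldExtType F) u :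
  (u \in norm_one_units L) = (u ^+ (\sum_(i < \dim {:L}) #|F| ^ i)%N == 1).
Proof.
rewrite inE ext_normE; have [->|//] := eqVneq u 0.
rewrite expr0n; case: (\dim _) (adim_gt0 {:L}) => // n _.
by rewrite big_ord_recl expn0 eq_sym oner_eq0.
Qed.

Lemma pm_norm_one_neq0 (F : finFieldType) (L : fieldExtType F) :
  0 \notin pm_norm_one_units L.
Proof.
rewrite inE negb_or inE eqxx /=; apply/imsetP=> -[u].
by rewrite inE => /andP[u_neq0 _] /esym/eqP; rewrite oppr_eq0 (negPf u_neq0).
Qed.

(** In degree two [-1] has norm one, so the signs add nothing. *)
Lemma pm_norm_one_unitsE (F : finFieldType) (L : fieldExtType F) :
  \dim {:L} = 2%N ->
  pm_norm_one_units L = [set u | u ^+ #|F|.+1 == 1].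
Proof.
move=> dimL; have cardL : #|finvect_type L| = (#|F| ^ 2)%N.
  by rewrite card_finvect dimL.
have normE u : (u \in norm_one_units L) = (u ^+ #|F|.+1 == 1).
  by rewrite norm_one_unitsE dimL !big_ord_recr big_ord0 /= expn0 expn1 add0n add1n.
have N1 := quadratic_normN1 cardL.
apply/setP=> u; rewrite [LHS]in_setU [RHS]inE -normE orb_idr // => /imsetP[v].
by rewrite !normE -[- v]mulN1r => /eqP vm ->; rewrite exprMn N1 vm mulr1.
Qed.

Lemma pm_norm_one_N (F : finFieldType) (L : fieldExtType F) u :
  u \in pm_norm_one_units L -> - u \in pm_norm_one_units L.
Proof.
rewrite !in_setU => /orP[Uu | /imsetP[v Uv ->]].
  by apply/orP; right; apply: imset_f.
by rewrite opprK Uv.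
Qed.

(** Zero is written as [1 + (-1)], and this is where the sign enters: in odd degree
    and odd characteristic [-1] has norm [-1]. *)
Lemma is_m_large_degree (F : finFieldType) (L : fieldExtType F) :
  (3 <= \dim {:L})%N -> is_m L 2.
Proof.
move=> dim_ge3; have cardL := card_finvect L.
split=> // [|[|[|k]] // _ /not_one_sum[]]; last exact: pm_norm_one_neq0.
apply/n_sum2P => x; have U1 : 1 \in pm_norm_one_units L.
  by rewrite in_setU norm_one_unitsE expr1n eqxx.
have [->|x0] := eqVneq x 0; first by exists 1, (-1); rewrite pm_norm_one_N // subrr.
have [u [v [um vm ->]]] :=
  @sum_two_norm_one F (finvect_type L) (in_alg (finvect_type L)) _ _ dim_ge3 cardL x0.
by exists u, v; rewrite !in_setU !norm_one_unitsE um vm eqxx.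
Qed.

Local Close Scope ring_scope.

Theorem theorem3p16 (F : finFieldType) (L : fieldExtType F)
    (nontrivial : (1 < \dim {:L})%N) :
  let q := #|F| in
  [/\ additively_generated_by (pm_norm_one_units L),
      graph_connected (cayley_adj (mem (pm_norm_one_units L))),
      exists2 n : nat, n \in [:: 2; 3; 4] & is_m L n
    & [/\ (3 <= \dim {:L})%N \/ (\dim {:L} = 2 /\ q \in [:: 2; 3]) ->
            is_m L 2,
          [/\ \dim {:L} = 2, q \notin [:: 2; 3]
            & [\/ q = 0 %[mod 3], q = 5 %[mod 6]
                | exists2 s : nat, q = (2 ^ s)%N & odd s]] ->
            is_m L 3
        & \dim {:L} = 2 /\
            (q = 1 %[mod 6] \/ exists2 s : nat, q = (2 ^ s)%N & ~~ odd s) ->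
            is_m L 4]].
Proof.
move=> q; have q_gt1 : (1 < q)%N := finNzRing_gt1 F.
have cardL : #|finvect_type L| = (q ^ \dim {:L})%N := card_finvect L.
have two_pow_mod3 s : (2 ^ s = 1 + odd s %[mod 3])%N.
  elim: s => //= s IHs; rewrite expnS -modnMmr IHs modnMmr.
  by case: (odd s).
have case2 : (3 <= \dim {:L})%N \/ (\dim {:L} = 2 /\ q \in [:: 2; 3]) -> is_m L 2.
  case=> [|[dimL q23]]; first exact: is_m_large_degree.
  rewrite /is_m (pm_norm_one_unitsE dimL); apply: quadratic_min2 => //.
  by rewrite cardL dimL.
have case3 : \dim {:L} = 2 -> q \notin [:: 2; 3] -> (q %% 3 != 1)%N -> is_m L 3.
  move=> dimL q23 q_mod; rewrite /is_m (pm_norm_one_unitsE dimL).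
  apply: quadratic_min3; rewrite ?cardL ?dimL //.
  by rewrite -/q; move: q23 q_gt1; rewrite !inE; case: (q) => [|[|[|[|]]]].
have case4 : \dim {:L} = 2 -> (q %% 3 = 1)%N -> is_m L 4.
  move=> dimL q_mod; rewrite /is_m (pm_norm_one_unitsE dimL).
  by apply: quadratic_min4; rewrite ?cardL ?dimL.
have [n n234 mLn] : exists2 n : nat, n \in [:: 2; 3; 4] & is_m L n.
  have [dim_ge3 | dim_le2] := leqP 3 (\dim {:L}).
    by exists 2%N => //; apply: case2; left.
  have dimL : \dim {:L} = 2 by apply/eqP; rewrite eqn_leq nontrivial -ltnS dim_le2.
  have [q23 | q23] := boolP (q \in [:: 2; 3]).
    by exists 2%N => //; apply: case2; right.
  have [q_mod | q_mod] := eqVneq (q %% 3)%N 1.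
    by exists 4%N => //; apply: case4.
  by exists 3%N => //; apply: case3.
have [_ sumS _] := mLn; split.
- exact: n_sum_generates sumS.
- by apply: n_sum_connected sumS => u; apply: pm_norm_one_N.
- by exists n.
split=> //.
  case=> dimL q23 q_mod; apply: case3 => //.
  case: q_mod => [q0 | q5 | [s -> s_odd]].
  - by rewrite q0.
  - by rewrite -(modn_dvdm q (isT : 3 %| 6)) q5.
  - by rewrite two_pow_mod3 s_odd.
case=> dimL q_mod; apply: case4 => //.
case: q_mod => [q1 | [s -> s_even]].
  by rewrite -(modn_dvdm q (isT : 3 %| 6)) q1.
by rewrite two_pow_mod3 (negPf s_even).
Qed.
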